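(* For every integer $d>2$ there is a directed tree in which every vertex has degree at most $d$ and every directed path has length at most one, and whose span is at least $\lfloor d/2\rfloor+1$.
   Context: A directed tree is a DAG (directed acyclic graph) whose underlying undirected graph is a tree. An upward-planar layered drawing of a DAG $G$ maps each vertex $v$ to a point in the plane whose y-coordinate $y(v)$ is an integer, and each edge $(u,v)$ (directed from tail $u$ to head $v$) to a strictly y-monotone curve going upward from $u$ to $v$ (so $y(u)<y(v)$), such that no two edges intersect except at common endpoints. The span of an edge $(u,v)$ in such a drawing $\Gamma$ is $y(v)-y(u)$; the span of $\Gamma$ is the maximum span of its edges; the span of an upward-planar DAG is the minimum span over all its upward-planar layered drawings. The degree of a vertex is its total number of incident edges. The length of a directed path is its number of edges. *)

(* Defs.v *)
From mathcomp Require Import all_boot.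
From Stdlib Require Import Reals ZArith.

Set Implicit Arguments.
Unset Strict Implicit.
Unset Printing Implicit Defensive.

Section Defs.
Variable T : finType.
Implicit Types (E : rel T).

Definition uadj E : rel T := fun x y => E x y || E y x.

Definition is_dag E : Prop :=
  forall (x : T) (p : seq T), path E x p -> last x p = x -> p = [::].

Definition uconnected E : Prop := forall x y : T, connect (uadj E) x y.

Definition uacyclic E : Prop :=
  forall (x : T) (p : seq T), path (uadj E) x p -> uniq (x :: p) ->
    2 <= size p -> ~~ uadj E (last x p) x.

Definition directed_tree E : Prop :=
  [/\ 0 < #|T|, is_dag E, uconnected E & uacyclic E].

Definition degree E (v : T) : nat := #|[set u | E v u]| + #|[set u | E u v]|.

Definition dipaths_le1 E : Prop := forall u v w : T, E u v -> E v w -> False.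

(* Upward-planar layered drawing.  Vertex v is drawn at (px v, IZR (py v)),
   with integer y-coordinate py v.  An edge (u,v) is drawn as the strictly
   y-monotone curve { (c u v t, t) | IZR (py u) <= t <= IZR (py v) }, where
   c u v is continuous. *)
Definition ulp_drawing E (px : T -> R) (py : T -> Z) (c : T -> T -> R -> R)
  : Prop :=
  (forall u v, px u = px v -> py u = py v -> u = v) /\
  (forall u v, E u v ->
     (py u < py v)%Z /\ (forall t, continuity_pt (c u v) t) /\
     c u v (IZR (py u)) = px u /\ c u v (IZR (py v)) = px v) /\
  (forall u v w, E u v -> w <> u -> w <> v ->
     ~ ((IZR (py u) <= IZR (py w) <= IZR (py v))%R /\
        c u v (IZR (py w)) = px w)) /\
  (forall u1 v1 u2 v2 (t : R), E u1 v1 -> E u2 v2 -> (u1, v1) <> (u2, v2) ->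
     (IZR (py u1) <= t <= IZR (py v1))%R ->
     (IZR (py u2) <= t <= IZR (py v2))%R ->
     c u1 v1 t = c u2 v2 t ->
     exists w, (w = u1 \/ w = v1) /\ (w = u2 \/ w = v2) /\
               t = IZR (py w) /\ c u1 v1 t = px w).

Definition upward_planar E : Prop :=
  exists px py c, ulp_drawing E px py c.

(* The span of the drawing (max edge span) is at least k. *)
Definition drawing_span_ge E (py : T -> Z) (k : Z) : Prop :=
  exists u v, E u v /\ (k <= py v - py u)%Z.

(* The span of the upward-planar DAG (minimum span over all drawings)
   is at least k. *)
Definition span_ge E (k : Z) : Prop :=
  upward_planar E /\
  forall px py c, ulp_drawing E px py c -> drawing_span_ge E py k.

End Defs.

(* Main.v *)
(** Write [k] for [d./2] and suppose that all edges have span at most [k].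
    If an edge [rv] leaves [r] between two edges [ra] and [rb] that end at least
    as high as [v], then all other neighbours of the sink [v] are drawn above [r], hence
    are less than [v - r] levels below [v]. By pigeonhole three of them share a
    level, so the same situation occurs upside down at [v] with a shorter edge;
    descending, we get a contradiction in any tree that is rich enough around
    [r]. Hence every vertex near [r] has at most two neighbours at each distance
    [1, ..., k], which forces [d = 2k] and exactly two at each distance. Then two
    edges [ra], [r'a] of span [k] enclose an edge of span [1] at [r], and behind
    it a vertex on the level of [r] whose own edges of span [k] cannot leave the
    wedge.

    The tree is the [d]-regular one cut off at a large depth, with edges directed
    from even to odd depth. It is drawn with the preorder number as abscissa,
    sources on their depth and sinks on a mirrored level above all sources. *)

Require Import Defs.
From mathcomp Require Import all_boot.
From Stdlib Require Import Reals ZArith Lra Lia.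
From mathcomp Require Import zify.

Set Implicit Arguments.
Unset Strict Implicit.
Unset Printing Implicit Defensive.

(** Intermediate value theorem for [f - g]. Both orders of [s] and [t] are allowed because curves
    are followed upwards and downwards. *)
Lemma continuous_order_const (f g : R -> R) (s t : R) :
  (forall x, continuity_pt f x) -> (forall x, continuity_pt g x) ->
  (forall x, (s <= x <= t \/ t <= x <= s)%R -> f x <> g x) ->
  (f s < g s)%R -> (f t < g t)%R.
Proof.
move=> cf cg neq lts.
have cfg : continuity (f - g)%F by move=> x; apply: continuity_pt_minus.
case: (Rlt_le_dec (f t) (g t)) => // let_.
have prod_le0 : ((f - g)%F s * (f - g)%F t <= 0)%R.
  by rewrite /minus_fct; nra.
case: (Rle_dec s t) => [le_st|/Rnot_le_lt/Rlt_le le_ts].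
  have [z [z_in]] := IVT_cor _ _ _ cfg le_st prod_le0.
  by rewrite /minus_fct => z0; case: (neq z); [left | lra].
rewrite Rmult_comm in prod_le0.
have [z [z_in]] := IVT_cor _ _ _ cfg le_ts prod_le0.
by rewrite /minus_fct => z0; case: (neq z); [right | lra].
Qed.

(** * Counting a set by the fibres of a level function *)

Section Counting.
Variable T : finType.
Implicit Types (S : {set T}) (f : T -> nat) (X : T -> R).

Lemma card_sum_fibers S f s :
  (forall x, x \in S -> 1 <= f x <= s) ->
  #|S| = \sum_(l < s) #|[set x in S | f x == l.+1]|.
Proof.
elim: s S => [|s IHs] S fS.
  rewrite big_ord0; apply/eqP; rewrite cards_eq0; apply/eqP/setP => x.
  by rewrite inE; apply/negP => /fS; lia.
rewrite big_ord_recr /= -(cardsID [set x | f x == s.+1] S) addnC; congr (_ + _).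
  rewrite IHs => [|x]; last by rewrite !inE => /andP[? /fS]; lia.
  apply: eq_bigr => l _; apply: eq_card => x; rewrite !inE.
  have := ltn_ord l; case: (x \in S); lia.
by apply: eq_card => x; rewrite !inE.
Qed.

Lemma card_le_double S f s :
  (forall x, x \in S -> 1 <= f x <= s) ->
  (forall l, #|[set x in S | f x == l]| <= 2) -> #|S| <= 2 * s.
Proof.
move=> fS le2; rewrite (card_sum_fibers fS).
apply: (@leq_trans (\sum_(l < s) 2)); first by apply: leq_sum => l _.
by rewrite sum_nat_const card_ord mulnC.
Qed.

Lemma card_fiber_eq2 S f s l :
  (forall x, x \in S -> 1 <= f x <= s) ->
  (forall l, #|[set x in S | f x == l]| <= 2) ->
  2 * s <= #|S| -> 1 <= l <= s -> #|[set x in S | f x == l]| = 2.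
Proof.
move=> fS le2 geS; case: l => // l lt_ls.
have := card_sum_fibers fS; rewrite (bigD1 (Ordinal lt_ls)) //= => eqS.
have : \sum_(i < s | i != Ordinal lt_ls) #|[set x in S | f x == i.+1]| <=
       \sum_(i < s | i != Ordinal lt_ls) 2 by apply: leq_sum.
rewrite sum_nat_const cardC1 card_ord.
have := le2 l.+1; move: geS; rewrite eqS /=.
by move: #|_| (\sum_(_ < s | _) _) => A B; move: lt_ls {eqS}; lia.
Qed.

Lemma three_sorted S X :
  2 < #|S| -> {in S &, forall x y, X x = X y -> x = y} ->
  exists a b c, [/\ a \in S, b \in S, c \in S & (X a < X b < X c)%R].
Proof.
case/card_gt2P=> a [b [c [[aS bS cS] [nab nbc nca]]]] Xinj.
have lt_or x y : x \in S -> y \in S -> x != y -> (X x < X y \/ X y < X x)%R.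
  move=> xS yS /eqP neq; case: (Rtotal_order (X x) (X y)) => [|[/Xinj|]]; auto.
  by move=> eqxy; case: neq; apply: eqxy.
case: (lt_or a b) => // ?; case: (lt_or b c) => // ?; case: (lt_or c a) => // ?;
  first [ by exists a, b, c | by exists a, c, b | by exists b, a, c
        | by exists b, c, a | by exists c, a, b | by exists c, b, a | lra ].
Qed.

End Counting.

(** * Rich vertices, and drawings under reflection *)

Section Flip.
Variable T : finType.
Implicit Types E : rel T.

Definition rev_rel E : rel T := fun u v => E v u.

(** Stands in for [d]-regularity, which a finite tree cannot have everywhere. Each step to a
    neighbour costs one unit of [m]. *)
Fixpoint rich E (d m : nat) (v : T) : Prop :=
  d <= degree E v /\
  (if m is m'.+1 then forall u, uadj E v u -> rich E d m' u else True).

Lemma rich_degree E d m v : rich E d m v -> d <= degree E v.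
Proof. by case: m => [|m] []. Qed.

Lemma rich_leq E d m m' v : m <= m' -> rich E d m' v -> rich E d m v.
Proof.
elim: m' m v => [|m' IHm] [|m] v //= le_m [dv nv]; split=> // u /nv.
exact: IHm.
Qed.

Lemma rich_rev E d m v : rich E d m v -> rich (rev_rel E) d m v.
Proof.
elim: m v => [|m IHm] v /= [dv nv]; split=> //; try by rewrite /degree addnC.
by move=> u; rewrite /uadj orbC => /nv/IHm.
Qed.

Lemma rich_adj E d m v u :
  rich E d m.+1 v -> E v u || E u v -> rich E d m u.
Proof. by case=> _; apply. Qed.

Definition thin E px py c (k : nat) : Prop :=
  [/\ dipaths_le1 E, @ulp_drawing T E px py c &
      forall u v, E u v -> (py v - py u <= Z.of_nat k)%Z].

Definition opp_lev (py : T -> Z) u := (- py u)%Z.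
Definition rev_curve (c : T -> T -> R -> R) u v t := c v u (- t)%R.

(** Reflection in a horizontal line swaps sources and sinks, so what is shown around a source also
    holds around a sink. *)
Lemma thin_rev E px py c k :
  thin E px py c k -> thin (rev_rel E) px (opp_lev py) (rev_curve c) k.
Proof.
case=> dip [inj [edge [vert cross]]] span; rewrite /rev_rel /opp_lev /rev_curve.
split; [by move=> u v w Evu Ewv; apply: dip Ewv Evu | | by move=> u v /span; lia].
split; [by move=> u v eqx eqy; apply: inj => //; lia | split; [|split]].
- move=> u v /edge[lt_uv [cont [cu cv]]]; split; first lia.
  rewrite !opp_IZR !Ropp_involutive; split=> // t.
  apply: (continuity_pt_comp (fun x => - x)%R) => //.
  by apply: continuity_pt_opp; apply: derivable_continuous_pt; apply: derivable_pt_id.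
- move=> u v w /vert Hw neu nev; rewrite !opp_IZR Ropp_involutive => -[rg eqc].
  by apply: (Hw w) => //; split=> //; lra.
- move=> u1 v1 u2 v2 t E1 E2 ne; rewrite !opp_IZR => r1 r2 eqc.
  have [||||w [w1 [w2 [tw cw]]]] := cross v1 u1 v2 u2 (- t)%R E1 E2; try lra; auto.
    by case=> eqv equ; apply: ne; rewrite eqv equ.
  exists w; split; [tauto | split; [tauto | split=> //]].
  by rewrite opp_IZR; lra.
Qed.

Lemma thin_mirror E px py c k :
  thin E px py c k ->
  thin E (fun u => - px u)%R py (fun u v t => - c u v t)%R k.
Proof.
case=> dip [inj [edge [vert cross]]] span; split=> //.
split; [by move=> u v eqx eqy; apply: inj => //; lra | split; [|split]].
- move=> u v /edge[lt_uv [cont [-> ->]]]; split=> //; split=> // t.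
  exact: continuity_pt_opp.
- move=> u v w /vert Hw neu nev [rg eqc].
  by apply: (Hw w) => //; split=> //; lra.
- move=> u1 v1 u2 v2 t E1 E2 ne r1 r2 eqc.
  have [||||w [w1 [w2 [tw cw]]]] := cross u1 v1 u2 v2 t E1 E2; try lra; auto.
  by exists w; rewrite cw.
Qed.

End Flip.

(** * Drawings with all spans at most [k] *)

Section ThinDrawing.
Variables (T : finType) (d k : nat).
Implicit Types (E : rel T) (px : T -> R) (py : T -> Z) (c : T -> T -> R -> R).

(* Integrality of the levels makes the level just above [r] meet all curves
   leaving [r], so they are ordered from left to right by these abscissas. *)
Definition start py c r v : R := c r v (IZR (py r + 1)).

(** The curves can only meet in a common endpoint. The heads differ, a head is never a tail by
    [dipaths_le1], and a common tail lies below both heights. *)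
Lemma edge_order E px py c u v u' v' (s t : R) :
  thin E px py c k -> E u v -> E u' v' -> v <> v' ->
  (u = u' -> IZR (py u) < s /\ IZR (py u) < t)%R ->
  (IZR (py u) <= s <= IZR (py v))%R -> (IZR (py u') <= s <= IZR (py v'))%R ->
  (IZR (py u) <= t <= IZR (py v))%R -> (IZR (py u') <= t <= IZR (py v'))%R ->
  (c u v s < c u' v' s)%R -> (c u v t < c u' v' t)%R.
Proof.
case=> dip [_ [edge [_ cross]]] _ Euv Euv' nev equ rs rs' rt rt'.
have [_ [cont _]] := edge _ _ Euv; have [_ [cont' _]] := edge _ _ Euv'.
apply: continuous_order_const => // x rx eqc.
have [|||w [w1 [w2 [xw _]]]] := cross u v u' v' x Euv Euv' _ _ _ eqc.
- by case=> _ /nev.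
- by case: rx; lra.
- by case: rx; lra.
case: w1 => eqw1; rewrite {w}eqw1 in w2 xw; case: w2 => eqw.
- by have := equ eqw; case: rx; lra.
- by apply: (dip u' u v) => //; rewrite eqw.
- by apply: (dip u v v') => //; rewrite eqw.
- by apply: nev.
Qed.

Lemma edge_lev E px py c u v : thin E px py c k -> E u v -> (py u < py v)%Z.
Proof. by case=> _ [_ [edge _]] _ /edge[]. Qed.

Lemma curve_tail E px py c u v :
  thin E px py c k -> E u v -> c u v (IZR (py u)) = px u.
Proof. by case=> _ [_ [edge _]] _ /edge[_ [_ []]]. Qed.

Lemma curve_head E px py c u v :
  thin E px py c k -> E u v -> c u v (IZR (py v)) = px v.
Proof. by case=> _ [_ [edge _]] _ /edge[_ [_ []]]. Qed.

(** If the heads differed, the common point would have to be [r], which lies one level lower. *)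
Lemma start_inj E px py c r v v' :
  thin E px py c k -> E r v -> E r v' ->
  start py c r v = start py c r v' -> v = v'.
Proof.
move=> thn Ev Ev' eqs; apply/eqP; case: eqP => // nev.
case: (thn) => dip [_ [_ [_ cross]]] _.
have lt_v := edge_lev thn Ev; have lt_v' := edge_lev thn Ev'.
have [|||w [w1 [w2 [xw _]]]] := cross r v r v' _ Ev Ev' _ _ _ eqs.
- by case=> /nev.
- by split; apply: IZR_le; lia.
- by split; apply: IZR_le; lia.
have eqw : w = r.
  case: w1 w2 => [-> //|->] [] // eqv; by case: nev.
by move/eq_IZR: xw; rewrite eqw; lia.
Qed.

(** At the level of [v], the curves [ra] and [rb] pass on either side of [v]. If [u] were not above
    [r], the curve [uv] followed down from [v] would stay strictly between them, but at the level of
    [r] they meet. *)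
Lemma enclosed_above E px py c r a v b u :
  thin E px py c k -> E r a -> E r v -> E r b ->
  (start py c r a < start py c r v < start py c r b)%R ->
  (py v <= py a)%Z -> (py v <= py b)%Z -> E u v -> u <> r -> (py r < py u)%Z.
Proof.
move=> thn Ea Ev Eb [Xav Xvb] le_va le_vb Eu neur.
case: (Z_lt_ge_dec (py r) (py u)) => // /Z.ge_le le_ur.
have lt_rv := edge_lev thn Ev.
have neav : a <> v by move=> eqv; move: Xav; rewrite eqv; lra.
have nevb : v <> b by move=> eqv; move: Xvb; rewrite eqv; lra.
have lt_av : (c r a (IZR (py v)) < px v)%R.
  rewrite -(curve_head thn Ev).
  apply: (edge_order thn Ea Ev neav) Xav => [_||||];
    (split; try apply: IZR_lt; try apply: IZR_le; lia).
have lt_vb : (px v < c r b (IZR (py v)))%R.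
  rewrite -(curve_head thn Ev).
  apply: (edge_order thn Ev Eb nevb) Xvb => [_||||];
    (split; try apply: IZR_lt; try apply: IZR_le; lia).
have : (c r a (IZR (py r)) < c u v (IZR (py r)))%R.
  rewrite -(curve_head thn Eu) in lt_av.
  apply: (edge_order thn Ea Eu neav) lt_av => [/esym/neur//||||];
    (split; try apply: IZR_lt; try apply: IZR_le; lia).
have : (c u v (IZR (py r)) < c r b (IZR (py r)))%R.
  rewrite -(curve_head thn Eu) in lt_vb.
  apply: (edge_order thn Eu Eb nevb) lt_vb => [/neur//||||];
    (split; try apply: IZR_lt; try apply: IZR_le; lia).
by rewrite (curve_tail thn Ea) (curve_tail thn Eb); lra.
Qed.

Definition lev_diff py r v : nat := Z.to_nat (py v - py r).

Lemma degree_tail E r v : dipaths_le1 E -> E r v ->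
  degree E r = #|[set u | E r u]|.
Proof.
move=> dip Erv; rewrite /degree [X in _ + X]eq_card0 ?addn0 // => u.
by rewrite !inE; apply/negP => Eur; apply: dip Eur Erv.
Qed.

Lemma three_enclosed E px py c r (S : {set T}) l :
  thin E px py c k -> (forall v, v \in S -> E r v) ->
  2 < #|[set v in S | lev_diff py r v == l]| ->
  exists a v b, [/\ a \in S, v \in S, b \in S,
    (start py c r a < start py c r v < start py c r b)%R &
    py v = py a /\ py v = py b].
Proof.
move=> thn ES gt2.
have [|a [v [b [aS vS bS lt_avb]]]] := three_sorted (X := start py c r) gt2.
  by move=> x y; rewrite !inE => /andP[/ES Ex _] /andP[/ES Ey _]; exact: start_inj thn Ex Ey.
move: aS vS bS; rewrite !inE /lev_diff => /andP[aS /eqP la] /andP[vS /eqP lv] /andP[bS /eqP lb].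
exists a, v, b; split=> //.
(* [Z.to_nat] truncates, so equal differences give equal levels only because heads lie above [r]. *)
have := edge_lev thn (ES _ aS); have := edge_lev thn (ES _ vS).
by have := edge_lev thn (ES _ bS); lia.
Qed.

(* All other neighbours of an enclosed [v] are closer to [v] than [r]; three of
   them lie on a common level, and the middle one is enclosed upside down by a
   shorter edge. *)
Lemma no_enclosed s E px py c r a v b :
  2 * s <= d -> thin E px py c k -> E r a -> E r v -> E r b ->
  (start py c r a < start py c r v < start py c r b)%R ->
  (py v <= py a)%Z -> (py v <= py b)%Z -> rich E d s v ->
  (py v - py r <= Z.of_nat s)%Z -> False.
Proof.
elim: s E px py c r a v b => [|s IHs] E px py c r a v b le_sd thn Ea Ev Eb X le_a le_b.
  by move=> _; have := edge_lev thn Ev; lia.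
move=> richv le_s; have thn' := thin_rev thn.
have Evr : rev_rel E v r by [].
have dip' : dipaths_le1 (rev_rel E) by case: thn'.
set S := [set u | rev_rel E v u] :\ r.
have ES u : u \in S -> rev_rel E v u by rewrite !inE => /andP[].
(* Of at least [2 * s + 2] neighbours, removing [r] leaves more than two for each of [s] levels. *)
have cardS : 2 * s < #|S|.
  have := rich_degree (rich_rev richv).
  by rewrite (degree_tail dip' Evr) (cardsD1 r) inE Evr -/S; lia.
have [/forallP le2|/forallPn[l]] :=
    boolP [forall l : 'I_s.+1, #|[set u in S | lev_diff (opp_lev py) v u == l]| <= 2].
  suff : #|S| <= 2 * s by lia.
  (* [u] lies strictly above [r], so its distance from [v] is at most [s]. *)
  have levS u : u \in S -> 1 <= lev_diff (opp_lev py) v u <= s.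
    rewrite !inE => /andP[/eqP neur Euv]; rewrite /lev_diff /opp_lev.
    have := enclosed_above thn Ea Ev Eb X le_a le_b Euv neur.
    by have := edge_lev thn Euv; lia.
  apply: (card_le_double levS) => l.
  case: (ltnP l s.+1) => lt_l; first exact: (le2 (Ordinal lt_l)).
  rewrite [X in X <= _]eq_card0 // => u; rewrite inE.
  by apply/negP => /andP[/levS + /eqP eql]; rewrite eql; lia.
rewrite -ltnNge => /(three_enclosed thn' ES)[a' [u [b' [/ES aS uS /ES bS X' [la lb]]]]].
have neur : u <> r by move: uS; rewrite !inE => /andP[/eqP].
have Eu := ES _ uS.
apply: (IHs _ _ _ _ _ _ _ _ _ thn' aS Eu bS X'); first lia.
- by rewrite la; lia.
- by rewrite lb; lia.
- by apply: rich_rev; apply: rich_adj richv _; rewrite [E u v]Eu orbT.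
- have := enclosed_above thn Ea Ev Eb X le_a le_b Eu neur.
  by rewrite /opp_lev; lia.
Qed.

(** * Two neighbours on each level around a rich vertex *)

Section Levels.
Variables (E : rel T) (px : T -> R) (py : T -> Z) (c : T -> T -> R -> R) (r x : T).
Hypotheses (le_kd : 2 * k <= d) (thn : thin E px py c k).
Hypotheses (Erx : E r x) (richr : rich E d k.+1 r).

Let S := [set v | E r v].

Lemma lev_diff_bounds v : v \in S -> 1 <= lev_diff py r v <= k.
Proof.
rewrite inE => Erv; have := edge_lev thn Erv; case: thn => _ _ /(_ _ _ Erv).
by rewrite /lev_diff; lia.
Qed.

Lemma fiber_le2 l : #|[set v in S | lev_diff py r v == l]| <= 2.
Proof.
rewrite leqNgt; apply/negP.
have ES v : v \in S -> E r v by rewrite inE.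
case/(three_enclosed thn ES)=> a [v [b [/ES Ea /ES Ev /ES Eb X [la lb]]]].
apply: (no_enclosed le_kd thn Ea Ev Eb X); try lia.
  by apply: rich_adj richr _; rewrite Ev.
by case: thn => _ _ /(_ _ _ Ev).
Qed.

Lemma rich_le_double : d <= 2 * k.
Proof.
have dip : dipaths_le1 E by case: thn.
have := rich_degree richr; rewrite (degree_tail dip Erx) => le_d.
exact: leq_trans le_d (card_le_double lev_diff_bounds fiber_le2).
Qed.

(** There are at least [2 * k] heads on [k] levels with at most two on each, so every bound is
    tight. *)
Lemma two_per_level l : 1 <= l <= k ->
  exists p q, [/\ p <> q, E r p, E r q, (py p - py r = Z.of_nat l)%Z &
                  (py q - py r = Z.of_nat l)%Z].
Proof.
move=> l_in; have dip : dipaths_le1 E by case: thn.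
have := rich_degree richr; rewrite (degree_tail dip Erx) => le_d.
have eq2 := card_fiber_eq2 lev_diff_bounds fiber_le2 (leq_trans le_kd le_d) l_in.
have /card_gt1P[p [q [pF qF /eqP nepq]]] :
  1 < #|[set v in S | lev_diff py r v == l]| by rewrite eq2.
exists p, q; move: pF qF; rewrite !inE /lev_diff.
case/andP=> Ep /eqP lp /andP[Eq /eqP lq]; split=> //; lia.
Qed.

Lemma other_on_level l z : 1 <= l <= k ->
  exists2 p, p <> z & E r p /\ (py p - py r = Z.of_nat l)%Z.
Proof.
case/two_per_level=> p [q [nepq Ep Eq lp lq]].
case: (p =P z) => [eqp|]; last by exists p.
by exists q => // eqq; apply: nepq; rewrite eqp.
Qed.

End Levels.

(** The one cycle that the wedge argument must exclude: two sources with two common sinks. *)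
Lemma no_four_cycle E u v w z :
  uacyclic E -> E u v -> E w v -> E w z -> E u z -> u <> w -> v <> z ->
  dipaths_le1 E -> False.
Proof.
move=> acyc Euv Ewv Ewz Euz /eqP neuw /eqP nevz dip.
have src a b a' b' : E a b -> E a' b' -> a != b'.
  by move=> Eab Eab'; apply/eqP => eqa; apply: (dip a' b' b) => //; rewrite -eqa.
have /acyc : path (uadj E) u [:: v; w; z].
  by rewrite /= /uadj Euv Ewv Ewz !orbT.
move/(_ _ isT) => /=; rewrite /uadj Euz orbT => H; apply/notF/H.
rewrite /= !inE !negb_or neuw nevz andbT /=.
rewrite (src u v u v) // (src u v u z) //= (src w z w z) // andbT.
by rewrite eq_sym (src w v w v).
Qed.

(* The edges [r'a] and [ra] bound a region of height [k]. The lowest child [v]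
   of [r] towards [r'] lies inside, so does a further neighbour [w] of [v] on
   the level of [r], and no edge from [w] can climb [k] levels there. *)
Lemma no_wedge E px py c r r' a :
  2 * k <= d -> 2 <= k -> thin E px py c k -> uacyclic E ->
  E r a -> E r' a -> py r' = py r -> (py a - py r = Z.of_nat k)%Z ->
  (px r' < px r)%R -> rich E d k.+3 r -> False.
Proof.
move=> le_kd k2 thn acyc Ea Ea' lr la lt_rr richr.
have dip : dipaths_le1 E by case: thn.
have richr1 : rich E d k.+1 r by apply: rich_leq richr; lia.
have [p [q [nepq Ep Eq lp lq]]] := two_per_level le_kd thn Ea richr1 (l := 1) ltac:(lia).
have nepa : p <> a by move=> eqp; move: la; rewrite -eqp; lia.
have neqa : q <> a by move=> eqp; move: la; rewrite -eqp; lia.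
have rich_child x : E r x -> rich E d k.+2 x.
  by move=> Ex; apply: rich_adj richr _; rewrite Ex.
(* Two children one level up cannot both start to the right of [a]: the nearer one would be enclosed
   by [a] and the other. *)
have no_right x y : E r x -> E r y -> (py x - py r = 1)%Z -> (py y - py r = 1)%Z ->
    (start py c r a < start py c r x < start py c r y)%R -> False.
  move=> Ex Ey lx ly X; apply: (no_enclosed le_kd thn Ea Ex Ey X); try lia.
  by apply: rich_leq (rich_child _ Ex); lia.
have [v [Ev lv lt_va]] :
    exists v, [/\ E r v, (py v - py r = 1)%Z & (start py c r v < start py c r a)%R].
  case: (Rtotal_order (start py c r p) (start py c r a)) => [|[/(start_inj thn Ep Ea)//|gt_p]].
    by exists p.
  case: (Rtotal_order (start py c r q) (start py c r a)) => [|[/(start_inj thn Eq Ea)//|gt_q]].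
    by exists q.
  case: (Rtotal_order (start py c r p) (start py c r q))
    => [lt_pq|[/(start_inj thn Ep Eq)//|lt_qp]].
    by case: (no_right p q).
  by case: (no_right q p).
have neva : v <> a by move=> eqv; move: la; rewrite -eqv; lia.
have richv : rich (rev_rel E) d k.+1 v.
  by apply: rich_rev; apply: rich_leq (rich_child _ Ev); lia.
have [w newr [Ew lw]] :=
  other_on_level le_kd (thin_rev thn) (x := r) Ev richv (l := 1) r ltac:(lia).
rewrite /rev_rel /opp_lev in Ew lw.
have richw : rich E d k.+1 w.
  by apply: rich_adj (rich_child _ Ev) _; rewrite Ew orbT.
have [z neza [Ez lz]] := other_on_level le_kd thn Ew richw (l := k) a ltac:(lia).
(* Otherwise [r], [a], [r'], [v] would form a cycle. *)
have newr' : w <> r'.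
  move=> eqw; apply: (no_four_cycle acyc Ea Ea' _ Ev) => [|eqr||//].
  - by rewrite -eqw.
  - by move: lt_rr; rewrite eqr; lra.
  - by apply/nesym.
(* Going up from [r] to [v], then down the edge from [w] to [v], one stays between the curves [r'a]
   and [ra]. *)
have lt_vr' : (c r' a (IZR (py v)) < px v)%R.
  have lt0 : (c r' a (IZR (py r)) < c r v (IZR (py r)))%R.
    by rewrite (curve_tail thn Ev) -lr (curve_tail thn Ea').
  rewrite -(curve_head thn Ev).
  apply: (edge_order thn Ea' Ev _ _ _ _ _ _ lt0) => [eqa|eqr||||];
    try (split; apply: IZR_le; lia).
    by apply: neva.
  by move: lt_rr; rewrite eqr; lra.
have lt_va' : (px v < c r a (IZR (py v)))%R.
  have eq1 : (py r + 1 = py v)%Z by lia.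
  by move: lt_va; rewrite /start eq1 (curve_head thn Ev).
have lt_r'w : (c r' a (IZR (py r)) < px w)%R.
  have eqw : py r = py w by lia.
  rewrite -(curve_tail thn Ew) -eqw.
  rewrite -(curve_head thn Ew) in lt_vr'.
  apply: (edge_order thn Ea' Ew _ _ _ _ _ _ lt_vr') => [eqa|/esym/newr'//||||];
    try (split; apply: IZR_le; lia).
  by apply: neva.
have lt_wr : (px w < c r a (IZR (py r)))%R.
  have eqw : py r = py w by lia.
  rewrite -(curve_tail thn Ew) -eqw.
  rewrite -(curve_head thn Ew) in lt_va'.
  by apply: (edge_order thn Ew Ea _ _ _ _ _ _ lt_va') => [//|/newr//||||];
    try (split; apply: IZR_le; lia).
have eqwr : py r = py w by lia.
have eqza : py z = py a by lia.
rewrite -(curve_tail thn Ez) -eqwr in lt_r'w lt_wr.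
(* Up to the level of [a], the curve [wz] stays strictly between two curves that end in the same
   point. *)
have : (c r' a (IZR (py a)) < c w z (IZR (py a)))%R.
  by apply: (edge_order thn Ea' Ez _ _ _ _ _ _ lt_r'w) => [/esym//|/esym/newr'//||||];
    split; apply: IZR_le; lia.
have : (c w z (IZR (py a)) < c r a (IZR (py a)))%R.
  by apply: (edge_order thn Ez Ea _ _ _ _ _ _ lt_wr) => [//|/newr//||||];
    split; apply: IZR_le; lia.
by rewrite (curve_head thn Ea) (curve_head thn Ea'); lra.
Qed.

(** Two sources on one level with a common head [k] levels higher give the wedge. From [2 < d] comes
    [2 <= k], and [k.+3] leaves [k.+1] after the two steps that [no_wedge] walks away from [r]. *)
Theorem no_thin_drawing E px py c r x :
  2 < d -> 2 * k <= d -> thin E px py c k -> uacyclic E ->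
  E r x -> rich E d k.+3 r -> False.
Proof.
move=> d3 le_kd thn acyc Ex richr.
have richr1 : rich E d k.+1 r by apply: rich_leq richr; lia.
have k2 : 2 <= k by have := rich_le_double le_kd thn Ex richr1; lia.
have [a _ [Ea la]] := other_on_level le_kd thn Ex richr1 (l := k) r ltac:(lia).
have richa : rich (rev_rel E) d k.+1 a.
  apply: rich_rev; apply: (@rich_leq _ _ _ _ k.+2) => //.
  by apply: rich_adj richr _; rewrite Ea.
have [r' ner [Ea' la']] :=
  other_on_level le_kd (thin_rev thn) (x := r) Ea richa (l := k) r ltac:(lia).
rewrite /rev_rel /opp_lev in Ea' la'.
have lr : py r' = py r by lia.
case: (Rtotal_order (px r') (px r)) => [lt_rr|[eqx|lt_rr]].
- exact: (no_wedge le_kd k2 thn acyc Ea Ea').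
- by case: thn => _ [/(_ _ _ eqx lr)/ner].
- by apply: (no_wedge le_kd k2 (thin_mirror thn) acyc Ea Ea') => //; lra.
Qed.

End ThinDrawing.

(** This is max(0, min(1, x)), written with absolute values to inherit their continuity. *)
Definition clamp (x : R) : R := ((Rabs x - Rabs (x - 1) + 1) / 2)%R.

Lemma clamp_le0 x : (x <= 0)%R -> clamp x = 0%R.
Proof. by move=> ?; rewrite /clamp !Rabs_left1; lra. Qed.

Lemma clamp_ge1 x : (1 <= x)%R -> clamp x = 1%R.
Proof. by move=> ?; rewrite /clamp !Rabs_pos_eq; lra. Qed.

Lemma clamp_mid x : (0 <= x <= 1)%R -> clamp x = x.
Proof. by move=> ?; rewrite /clamp Rabs_pos_eq ?Rabs_left1; lra. Qed.

Lemma clamp_bounds x : (0 <= clamp x <= 1)%R.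
Proof.
case: (Rle_dec x 0) => [/clamp_le0->|?]; first lra.
case: (Rle_dec 1 x) => [/clamp_ge1->|?]; first lra.
by rewrite clamp_mid; lra.
Qed.

Lemma clamp_eq0 x : clamp x = 0%R -> (x <= 0)%R.
Proof.
move=> eq0; case: (Rle_dec x 0) => // gt0.
case: (Rle_dec 1 x) => [/clamp_ge1|?]; first lra.
by move: eq0; rewrite clamp_mid; lra.
Qed.

Lemma continuous_clamp : continuity clamp.
Proof.
have cont_shift a : continuity (fun x => x + a)%R.
  apply: continuity_plus; first exact: derivable_continuous derivable_id.
  by apply: continuity_const.
have cont_abs : continuity (fun x => Rabs x) by apply: Rcontinuity_abs.
have cont_abs1 : continuity (fun x => Rabs (x - 1)).
  exact: (continuity_comp (fun x => x - 1)%R _ (cont_shift (- 1)%R) cont_abs).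
have cont_num : continuity (fun x => Rabs x - Rabs (x - 1) + 1)%R.
  exact: (continuity_comp _ _ (continuity_minus _ _ cont_abs cont_abs1) (cont_shift 1%R)).
apply: (continuity_mult _ (fct_cte (/ 2)%R) cont_num).
by apply: continuity_const.
Qed.

(** * The tree of words and its degrees *)

Section WordTree.
Variables (m n : nat).
Local Notation T := (n.-bseq 'I_m.+1).
Implicit Types (u v w q j : T) (p s : seq 'I_m.+1) (b : 'I_m.+1).

Definition child q j : bool := [exists b, j == rcons q b :> seq _].

Definition tree_edge : rel T :=
  fun u v => ~~ odd (size u) && (child u v || child v u).
Local Notation E := tree_edge.

Lemma childP q j : reflect (exists b, j = rcons q b :> seq _) (child q j).
Proof. by apply: (iffP existsP) => -[b /eqP]; exists b => //; apply/eqP. Qed.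

Lemma size_child q j : child q j -> size j = (size q).+1.
Proof. by case/childP=> b eqj; rewrite eqj size_rcons. Qed.

Lemma child_inj q q' j : child q j -> child q' j -> q = q'.
Proof.
case/childP=> b eqj /childP[b' /eqP]; rewrite eqj eqseq_rcons => /andP[/eqP eqq _].
exact: val_inj.
Qed.

Lemma uadj_tree u v : uadj E u v = child u v || child v u.
Proof.
rewrite /uadj /tree_edge [child v u || _]orbC -andb_orl.
case: (boolP (child u v || child v u)); rewrite ?andbF ?andbT //.
by case/orP=> /size_child ->; rewrite /= negbK; case: (odd _).
Qed.

Lemma odd_size_edge u v : E u v -> ~~ odd (size u) /\ odd (size v).
Proof.
case/andP=> ou /orP[] /size_child eqs; split=> //; first by rewrite eqs.
by move: ou; rewrite eqs /= negbK.
Qed.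

Lemma dipaths_le1_tree : dipaths_le1 E.
Proof. by move=> u v w /odd_size_edge[_ ov] /odd_size_edge[]; rewrite ov. Qed.

Lemma is_dag_tree : is_dag E.
Proof.
move=> u [|v [|w p]] //= /andP[Euv].
  by move=> _ eqv; have [/negP] := odd_size_edge Euv; rewrite eqv.
by case/andP=> Evw; case: (dipaths_le1_tree Euv Evw).
Qed.

Lemma uconnected_tree : uconnected E.
Proof.
have symE : connect_sym (uadj E).
  by apply: sym_connect_sym => u v; rewrite /uadj orbC.
have root s (lt_s : size s <= n) : connect (uadj E) [bseq] (Bseq lt_s).
  elim/last_ind: s lt_s => [|s b IHs] lt_s.
    by apply/eq_connect0/val_inj.
  have lt_s' : size s <= n by move: lt_s; rewrite size_rcons; lia.
  apply: connect_trans (IHs lt_s') (connect1 _).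
  by rewrite uadj_tree; apply/orP; left; apply/childP; exists b.
move=> [u lt_u] [v lt_v]; apply: connect_trans (root _ lt_v).
by rewrite symE.
Qed.

(* In a cycle, both neighbours of a deepest vertex would be its parent. *)
Lemma uacyclic_tree : uacyclic E.
Proof.
move=> x p px_ uniq_xp size_p; apply/negP => closing.
have cyc : cycle (uadj E) (x :: p) by rewrite /= rcons_path px_.
have [y y_in maxy] : exists2 y, y \in x :: p & forall z : T, z \in x :: p -> size z <= size y.
  case: (arg_maxnP (P := fun y => y \in x :: p) (fun y : T => size y) (mem_head x p)) => y yP maxy.
  by exists y.
have [i p' rot_p] := rot_to y_in.
move: cyc uniq_xp; rewrite -(rot_cycle i) -(rot_uniq i) rot_p => cyc uniq_p'.
have size_p' : 2 <= size p'.
  by have := congr1 size rot_p; rewrite size_rot => -[<-].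
have maxp (z : T) : z \in p' -> size z <= size y.
  by move=> zp; apply: maxy; rewrite -(mem_rot i) rot_p inE zp orbT.
have parent (z : T) : z \in p' -> uadj E y z -> child z y.
  move=> zp; rewrite uadj_tree => /orP[/size_child eqz|//].
  by have := maxp z zp; rewrite eqz ltnn.
case: p' => [|a p'] // in cyc uniq_p' size_p' parent {rot_p maxp} *.
case/lastP: p' => [|p' b] // in cyc uniq_p' size_p' parent *.
move: cyc; rewrite /= !rcons_path last_rcons => /andP[ya /andP[_ by_]].
have eqab : a = b.
  apply: (@child_inj _ _ y).
    by apply: parent ya; rewrite mem_head.
  apply: parent; first by rewrite inE mem_rcons mem_head orbT.
  by move: by_; rewrite /uadj orbC.
by move: uniq_p'; rewrite /= eqab mem_rcons mem_head /= andbF.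
Qed.

Lemma directed_tree_tree : directed_tree E.
Proof.
split; [by apply/card_gt0P; exists [bseq] | exact: is_dag_tree |
        exact: uconnected_tree | exact: uacyclic_tree].
Qed.

Lemma degree_adj v :
  degree E v = #|[set u | child v u]| + #|[set u | child u v]|.
Proof.
have -> : degree E v = #|[set u | uadj E v u]|.
  rewrite /degree; case: (boolP (odd (size v))) => ov.
    rewrite [X in X + _]eq_card0 ?add0n => [|u]; last by rewrite !inE /tree_edge ov.
    by apply: eq_card => u; rewrite !inE /uadj [E v u]/tree_edge ov.
  have no_in u : E u v = false.
    by apply/negP => /odd_size_edge[_]; rewrite (negbTE ov).
  rewrite [X in _ + X]eq_card0 ?addn0 => [|u]; last by rewrite !inE no_in.
  by apply: eq_card => u; rewrite !inE /uadj no_in orbF.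
rewrite -(cardsID [set u | child v u]); congr (_ + _).
  apply: eq_card => u; rewrite !inE uadj_tree.
  by case: (child v u); rewrite ?andbF.
apply: eq_card => u; rewrite !inE uadj_tree.
case: (boolP (child v u)) => [/size_child eqs|] //=.
by apply/esym/negbTE/negP => /size_child; lia.
Qed.

Lemma card_children v :
  #|[set u | child v u]| = if size v < n then m.+1 else 0.
Proof.
case: ltnP => size_v.
  pose f b := insub_bseq n (rcons v b).
  have val_f b : val (f b) = rcons v b by rewrite insubdK // /in_mem /= size_rcons.
  rewrite -[RHS]card_ord -(card_imset (f := f)).
    apply: eq_card => u; rewrite inE; apply/childP/imsetP => [[b equ]|[b _ ->]].
      by exists b => //; apply: val_inj; rewrite val_f.
    by exists b; apply: val_f.
  by move=> b b' /(congr1 val); rewrite !val_f => /rcons_inj[].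
rewrite eq_card0 // => u; rewrite !inE; apply/negbTE/negP => /size_child eqs.
by have := size_bseq u; rewrite eqs ltnNge size_v.
Qed.

Lemma card_parents v : #|[set u | child u v]| = (0 < size v).
Proof.
case: v => s; case/lastP: s => [|s b] size_s.
  rewrite eq_card0 // => u; rewrite !inE; apply/negbTE/negP => /size_child.
  by rewrite /size_bseq.
have size_s' : size s <= n by move: size_s; rewrite size_rcons; lia.
have childs : child (Bseq size_s') (Bseq size_s) by apply/childP; exists b.
rewrite size_rcons; apply/eqP/cards1P; exists (Bseq size_s').
apply/setP => u; rewrite !inE; apply/idP/eqP => [/child_inj|->//]; exact.
Qed.

Lemma degree_le v : degree E v <= m.+2.
Proof.
rewrite degree_adj card_children card_parents.
by have := leq_b1 (0 < size v); case: ifP; lia.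
Qed.

(** Walks of [k] steps from [v] reach neither the root, which has no parent, nor the words of length
    [n], which have no children. *)
Lemma rich_tree k v : k < size v -> size v + k < n -> rich E m.+2 k v.
Proof.
elim: k v => [|k IHk] v lt_k lt_n /=; split.
- by rewrite degree_adj card_children card_parents !ifT; lia.
- by [].
- by rewrite degree_adj card_children card_parents !ifT; lia.
- by move=> u; rewrite uadj_tree => /orP[] /size_child eqs; apply: IHk; lia.
Qed.

(* Position in the preorder traversal of the complete [m.+2]-ary tree of
   height [h], of which only [m.+1] children per node are used. *)
Fixpoint preorder h s : nat :=
  if h is h'.+1 then
    if s is b :: s' then 1 + b * expn m.+2 h' + preorder h' s' else 0
  else 0.

Lemma preorder_lt h s : preorder h s < expn m.+2 h.
Proof.
elim: h s => [|h IHh] [|b s]; rewrite ?expn_gt0 //= expnS.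
by have := IHh s; have := ltn_ord b; move: (preorder h s) (expn m.+2 h) => x N; nia.
Qed.

(** Words with different first letters fall into disjoint blocks of length [expn m.+2 h]. *)
Lemma preorder_head h (b b' : 'I_m.+1) s s' :
  b * expn m.+2 h + preorder h s <= b' * expn m.+2 h + preorder h s' -> b <= b'.
Proof.
have := preorder_lt h s'; move: (preorder h s) (preorder h s') (expn m.+2 h) => x x' N.
by nia.
Qed.

Lemma preorder_inj h s s' : size s <= h -> size s' <= h ->
  preorder h s = preorder h s' -> s = s'.
Proof.
elim: h s s' => [|h IHh] [|b s] [|b' s'] //= lt_s lt_s' eqp.
have eqb : b = b'.
  have le1 : b <= b' by apply: (@preorder_head h _ _ s s'); lia.
  have le2 : b' <= b by apply: (@preorder_head h _ _ s' s); lia.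
  by apply/val_inj/eqP; rewrite eqn_leq le1.
by move: eqp; rewrite eqb => eqp; rewrite (IHh s s') //; lia.
Qed.

Lemma preorder_rcons h s b : size s < h -> preorder h s < preorder h (rcons s b).
Proof.
elim: h s => [|h IHh] [|a s] //= lt_s.
by have := IHh s lt_s; lia.
Qed.

(** In preorder a subtree is numbered contiguously from its root, so what comes after [p] and no
    later than a child of [p] lies below [p]. *)
Lemma preorder_between h p b s : size p < h -> size s <= h ->
  preorder h p < preorder h s <= preorder h (rcons p b) -> prefix p s.
Proof.
elim: h p s => [|h IHh] [|a p] [|a' s] //= lt_p lt_s /andP[lt_qs le_sq].
have eqa : a = a'.
  have le1 : a <= a' by apply: (@preorder_head h _ _ p s); lia.
  have le2 : a' <= a by apply: (@preorder_head h _ _ s (rcons p b)); lia.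
  by apply/val_inj/eqP; rewrite eqn_leq le1.
by rewrite eqa eqxx /= in lt_qs le_sq *; apply: IHh => //; lia.
Qed.

(** * The upward-planar drawing of the tree *)

Definition abscissa u : R := INR (preorder n u).
(** The constant puts every sink at [n + 1] or higher, above all sources, and deeper vertices closer
    to the middle. *)
Definition level u : Z :=
  if odd (size u) then (2 * Z.of_nat n + 1 - Z.of_nat (size u))%Z
  else Z.of_nat (size u).
(* Signed distance of level [t] from vertex [q], positive towards its children. *)
Definition offset q t : R :=
  if odd (size q) then (IZR (level q) - t)%R else (t - IZR (level q))%R.
(* The edge moves to the abscissa of the child within one level of the parent,
   and is vertical from there on. *)
Definition child_curve q j t : R :=
  (abscissa q + (abscissa j - abscissa q) * clamp (offset q t))%R.
Definition curve u v : R -> R :=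
  if child u v then child_curve u v else child_curve v u.

Lemma abscissa_inj u v : abscissa u = abscissa v -> u = v.
Proof.
by move/INR_eq=> eqp; apply: val_inj; apply: preorder_inj eqp; apply: size_bseq.
Qed.

Lemma abscissa_child q j : child q j -> (abscissa q < abscissa j)%R.
Proof.
move=> cqj; have := size_bseq j; rewrite (size_child cqj) => lt_q.
case/childP: cqj => b eqj; apply: lt_INR; apply/ltP.
by rewrite eqj preorder_rcons.
Qed.

Lemma prefix_between q j w : child q j ->
  (abscissa q < abscissa w <= abscissa j)%R -> size q < size w /\ prefix q w.
Proof.
move=> cqj; have := size_bseq j; rewrite (size_child cqj) => lt_q.
case/childP: cqj => b eqj [/INR_lt/ltP lt_qw /INR_le/leP le_wj].
have pre : prefix q w.
  apply: (@preorder_between n q b); rewrite ?size_bseq //.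
  by rewrite lt_qw -eqj.
split=> //; case/prefixP: (pre) => -[|a s] eqw.
  by move: lt_qw; rewrite eqw cats0 ltnn.
by rewrite eqw size_cat /=; lia.
Qed.

(** The strip that holds all vertices at least as deep as [q]. It loses one level at each end with
    each step of depth. *)
Definition in_range q t : Prop :=
  (INR (size q) <= t <= 2 * INR n + 1 - INR (size q))%R.

Lemma level_even u : ~~ odd (size u) -> IZR (level u) = INR (size u).
Proof. by rewrite /level => /negbTE->; rewrite INR_IZR_INZ. Qed.

Lemma level_odd u : odd (size u) -> IZR (level u) = (2 * INR n + 1 - INR (size u))%R.
Proof. by rewrite /level => ->; rewrite minus_IZR plus_IZR mult_IZR -!INR_IZR_INZ. Qed.

Lemma in_range_level w : in_range w (IZR (level w)).
Proof.
have : (INR (size w) <= INR n)%R by apply/le_INR/leP/size_bseq.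
rewrite /in_range; case: (boolP (odd (size w))) => [/level_odd|/level_even] ->; lra.
Qed.

Lemma offset_ge1 q w t : size q < size w -> in_range w t -> (1 <= offset q t)%R.
Proof.
move=> lt_qw; have : (INR (size q) + 1 <= INR (size w))%R.
  by rewrite -S_INR; apply/le_INR/leP.
rewrite /in_range /offset; case: (boolP (odd (size q))) => oq.
  by rewrite (level_odd oq); lra.
by rewrite (level_even oq); lra.
Qed.

Lemma offset_eq0 q t : offset q t = 0%R -> t = IZR (level q).
Proof. by rewrite /offset; case: odd; lra. Qed.

Lemma child_curve_bounds q j t : child q j ->
  (abscissa q <= child_curve q j t <= abscissa j)%R.
Proof.
by move/abscissa_child; rewrite /child_curve; have := clamp_bounds (offset q t); nra.
Qed.

Lemma child_curve_parent q j : child_curve q j (IZR (level q)) = abscissa q.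
Proof.
rewrite /child_curve clamp_le0; first lra.
by rewrite /offset; case: odd; lra.
Qed.

Lemma child_curve_vertical q j t : (1 <= offset q t)%R ->
  child_curve q j t = abscissa j.
Proof. by move=> ge1; rewrite /child_curve clamp_ge1 //; lra. Qed.

Lemma child_curve_start q j t : child q j -> (0 <= offset q t)%R ->
  child_curve q j t = abscissa q -> t = IZR (level q).
Proof.
move/abscissa_child=> lt_qj ge0 eqc; apply: offset_eq0.
suff /clamp_eq0 : clamp (offset q t) = 0%R by lra.
by move: eqc; rewrite /child_curve; nra.
Qed.

Lemma continuous_child_curve q j t : continuity_pt (child_curve q j) t.
Proof.
have cont_off : continuity (offset q).
  rewrite /offset; case: odd; apply: continuity_minus;
    by [apply: continuity_const | exact: derivable_continuous derivable_id].
have cont_clamp := continuity_comp _ _ cont_off continuous_clamp.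
apply: (continuity_plus (fct_cte (abscissa q))); first by apply: continuity_const.
apply: (continuity_mult (fct_cte (abscissa j - abscissa q)%R)) => //.
by apply: continuity_const.
Qed.

(** Parent and child replace tail and head, which merges the two orientations. *)
Lemma edge_child u v : E u v ->
  exists q j, [/\ child q j, curve u v = child_curve q j,
    (q, j) = (u, v) \/ (q, j) = (v, u) &
    forall t, (IZR (level u) <= t <= IZR (level v))%R ->
      (0 <= offset q t)%R /\ in_range q t].
Proof.
move=> Euv; have [ou ov] := odd_size_edge Euv.
rewrite (level_even ou) (level_odd ov) /curve.
case/andP: Euv => _ /orP[] cuv; have eqs := size_child cuv.
  exists u, v; rewrite cuv; split=> //; first by left.
  move=> t; rewrite /offset (negbTE ou) (level_even ou) eqs S_INR /in_range; lra.
exists v, u; split=> //; last 1 first.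
- move=> t; rewrite /offset ov (level_odd ov) eqs S_INR /in_range; lra.
- by case: ifP => // /size_child; lia.
- by right.
Qed.

Lemma level_edge u v : E u v -> (level u < level v)%Z.
Proof.
move=> Euv; have [ou ov] := odd_size_edge Euv.
rewrite /level ov (negbTE ou); have := size_bseq u; have := size_bseq v.
by case/andP: Euv => _ /orP[] /size_child; lia.
Qed.

Lemma child_curve_child q j : child q j -> child_curve q j (IZR (level j)) = abscissa j.
Proof.
move=> cqj; apply: child_curve_vertical; apply: offset_ge1 (in_range_level j).
by rewrite (size_child cqj).
Qed.

(** Each curve stays between the abscissas of its ends. If [i] is not to the right of [q], they can
    only touch at [i = q]. Otherwise [i] is a proper descendant of [q]: either [p = q] and the
    curves fan out from there, or [p] is deeper and in its strip the curve to [j] is already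
    vertical, to the right of [i]. *)
Lemma child_curves_meet (p i : T) q j t :
  child p i -> child q j -> (0 <= offset q t)%R -> in_range p t ->
  (abscissa i < abscissa j)%R -> child_curve p i t = child_curve q j t ->
  exists w, [/\ w = p \/ w = i, w = q, t = IZR (level w) & child_curve p i t = abscissa w].
Proof.
move=> cpi cqj ge0 rg lt_ij eqc.
have bi := child_curve_bounds t cpi; have bj := child_curve_bounds t cqj.
case: (Rle_lt_dec (abscissa i) (abscissa q)) => [le_iq|lt_qi].
  have eqiq : i = q by apply: abscissa_inj; lra.
  exists q; rewrite eqc; split=> //; [by right | | by lra].
  by apply: child_curve_start cqj ge0 _; lra.
have [lt_s pre] : size q < size i /\ prefix q i by apply: (prefix_between cqj); lra.
rewrite (size_child cpi) ltnS leq_eqVlt in lt_s; case/orP: lt_s => [/eqP eqs|lt_s].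
  have eqqp : q = p.
    apply: val_inj; case/childP: cpi => b eqi; move: pre.
    by rewrite prefixE eqi -cats1 eqs take_size_cat // => /eqP.
  rewrite {}eqqp {q eqs} in cqj ge0 eqc lt_qi pre bj *.
  have lt_pi := abscissa_child cpi.
  have eq0 : clamp (offset p t) = 0%R by move: eqc; rewrite /child_curve; nra.
  exists p; split=> //; first by left.
    by apply: offset_eq0; have := clamp_eq0 eq0; lra.
  by rewrite /child_curve eq0; lra.
have : child_curve q j t = abscissa j.
  by apply: child_curve_vertical; apply: offset_ge1 rg.
by lra.
Qed.

Lemma upward_planar_tree : upward_planar E.
Proof.
exists abscissa, level, curve; split; [|split; [|split]].
- by move=> u v /abscissa_inj.
- move=> u v Euv; split; first exact: level_edge.
  have [q [j [cqj -> uv _]]] := edge_child Euv.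
  split; first exact: continuous_child_curve.
  by case: uv => -[<- <-]; rewrite child_curve_parent child_curve_child.
- move=> u v w Euv newu newv [rg].
  have [q [j [cqj -> uv _]]] := edge_child Euv => eqw.
  have [newq newj] : w <> q /\ w <> j by case: uv => -[-> ->].
  (* A vertex [w] on the curve is a proper descendant of [q], so at its level the curve is already
     at the abscissa of [j]. *)
  have := child_curve_bounds (IZR (level w)) cqj; rewrite eqw => bw.
  have neq : abscissa q <> abscissa w by move/abscissa_inj/esym.
  have nej : abscissa w <> abscissa j by move/abscissa_inj.
  apply: nej; rewrite -eqw; apply: child_curve_vertical.
  apply: offset_ge1 (in_range_level w).
  by case: (@prefix_between q j w cqj) => //; lra.
- move=> u v u' v' t Euv Euv' neuv rg rg'.
  have [q [j [cqj -> uv /(_ t rg)[ge0 rgq]]]] := edge_child Euv.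
  have [q' [j' [cqj' -> uv' /(_ t rg')[ge0' rgq']]]] := edge_child Euv' => eqc.
  suff [w [wqj wqj' tw cw]] : exists w, [/\ w = q \/ w = j, w = q' \/ w = j',
      t = IZR (level w) & child_curve q j t = abscissa w].
    exists w; split; [|split; [|split=> //]].
      by case: uv wqj => -[-> ->]; tauto.
    by case: uv' wqj' => -[-> ->]; tauto.
  case: (Rtotal_order (abscissa j) (abscissa j')) => [lt_j|[/abscissa_inj eqj|lt_j]].
  + have [w [wp wq tw cw]] := child_curves_meet cqj cqj' ge0' rgq lt_j eqc.
    by exists w; split=> //; left.
  (* Equal children have equal parents, so the edges agree or are opposite, and opposite edges would
     form a directed path. *)
  + rewrite -eqj in cqj' uv'; rewrite -(child_inj cqj cqj') in uv'.
    case: neuv; case: (uv) uv' => -[eq1 eq2] [] [eq1' eq2'].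
    - by rewrite -eq1 -eq2 -eq1' -eq2'.
    - by case: (dipaths_le1_tree Euv (w := u)); rewrite -eq1 -eq2 eq1' eq2'.
    - by case: (dipaths_le1_tree Euv (w := u)); rewrite -eq1 -eq2 eq1' eq2'.
    - by rewrite -eq1 -eq2 -eq1' -eq2'.
  + have [w [wp wq tw cw]] := child_curves_meet cqj' cqj ge0 rgq' lt_j (esym eqc).
    by exists w; split=> //; [left | rewrite eqc].
Qed.

End WordTree.

Theorem mainTheorem5 :
  forall d : nat, 2 < d ->
  exists (T : finType) (E : rel T),
    [/\ directed_tree E,
        (forall v : T, degree E v <= d),
        dipaths_le1 E &
        span_ge E (Z.of_nat (d./2 + 1))].
Proof.
case=> [|[|m]] // d3; pose k := m.+2./2; pose n := 4 * k + 20.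
exists (n.-bseq 'I_m.+1), (@tree_edge m n); split.
- exact: directed_tree_tree.
- exact: degree_le.
- exact: dipaths_le1_tree.
split; first exact: upward_planar_tree.
move=> px py c draw.
case: (boolP [exists u, exists v, tree_edge u v && (Z.of_nat (k + 1) <=? py v - py u)%Z]).
  case/existsP=> u /existsP[v /andP[Euv /Z.leb_le le_k]].
  by exists u, v.
move/existsPn=> short; exfalso.
have thn : thin (@tree_edge m n) px py c k.
  split=> //; first exact: dipaths_le1_tree.
  move=> u v Euv; move/existsPn/(_ v): (short u); rewrite Euv /=.
  by rewrite Z.leb_antisym negbK => /Z.ltb_lt; lia.
(* The depth is even, so that [r] is a source, and more than [k.+3] away from both depth 0 and depth
   [n]. *)
pose s := nseq (2 * k + 6) (ord0 : 'I_m.+1).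
have size_s : size s <= n by rewrite size_nseq /n; lia.
pose r : n.-bseq 'I_m.+1 := Bseq size_s.
have size_r : size r = 2 * k + 6 by rewrite size_nseq.
have [x Erx] : exists x, tree_edge r x.
  have : 0 < #|[set u | child r u]|.
    by rewrite card_children size_r ifT // /n; lia.
  case/card_gt0P=> x; rewrite inE => crx; exists x.
  by rewrite /tree_edge crx size_r oddD oddM.
apply: (@no_thin_drawing _ m.+2 k _ _ _ _ _ _ d3 _ thn _ Erx).
- by rewrite /k; have := odd_double_half m.+2; lia.
- exact: uacyclic_tree.
- by apply: rich_tree; rewrite size_r /n; lia.
Qed.
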